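(* Let $\mathcal{P}_0\subset\mathcal{P}$. Suppose that for each $P\in\mathcal{P}_0$ there exist (i) a deterministic rate function $g_P$ tending to zero as $n\to\infty$ such that $\mathcal{D}^{(n)}_{\mathcal{T}}\in\mathcal{O}_P(g_P(n))$, and (ii) a finite constant $C_P$ such that the conditional density $f_{X\mid Z}$ of $X$ given $Z$ satisfies $\sup_{x\in[0,1]}f_{X\mid Z}(x\mid z)\le C_P$ for almost all $z\in[0,1]^d$. Then for each fixed $P\in\mathcal{P}_0$, $$\|F-\hat F^{(m_n,n)}\|_{\mathcal{T},\infty}\in\mathcal{O}_P(g_P(n)),$$ given that the equidistant grids $(\tau_k)_{k=1}^{m_n}$ in $\mathcal{T}$ satisfy $\kappa_{m_n}\in o(g_P(n))$.
   Context: $\mathcal{P}$ is the set of distributions of $(X,Y,Z)$ on $[0,1]^{2+d}$ ($X,Y\in[0,1]$, $Z\in[0,1]^d$) that are absolutely continuous with respect to Lebesgue measure. Throughout, for every $z$ the conditional distribution of $X$ given $Z=z$ is continuous. $F(t\mid z)=P(X\le t\mid Z=z)$ is the conditional distribution function and $Q(\tau\mid z)=\inf\{t\in[0,1]: F(t\mid z)\ge\tau\}$ the conditional quantile function of $X$ given $Z=z$ under $P$. Fix $0<\tau_{\min}<\tau_{\max}<1$ and put $\mathcal{T}=[\tau_{\min},\tau_{\max}]$, $Q(\mathcal{T}\mid z)=[Q(\tau_{\min}\mid z),Q(\tau_{\max}\mid z)]$. For $f:[0,1]\times[0,1]^d\to\mathbb{R}$, $\|f\|_{\mathcal{T},\infty}=\sup_{z\in[0,1]^d}\sup_{t\in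 Q(\mathcal{T}\mid z)}|f(t,z)|$. A grid in $\mathcal{T}$ is a sequence $\tau_{\min}=\tau_1<\dots<\tau_m=\tau_{\max}$ with $m\ge2$; it is equidistant if $\tau_{k+1}-\tau_k$ is constant for $k=1,\dots,m-1$; its coarseness is $\kappa_m=\max_{k=1,\dots,m-1}(\tau_{k+1}-\tau_k)$. Put $\tau_0=0$, $\tau_{m+1}=1$. $\hat Q^{(n)}(\tau\mid z)$ denotes the predicted conditional $\tau$-quantile of a quantile regression procedure fitted on an i.i.d. sample $(X_i,Z_i)_{i=1}^n$ from $P$, and $\mathcal{D}^{(n)}_{\mathcal{T}}=\sup_{z\in[0,1]^d}\sup_{\tau\in\mathcal{T}}|Q(\tau\mid z)-\hat Q^{(n)}(\tau\mid z)|$. Given a grid, let $\hat q_{0,z}=0$, $\hat q_{m+1,z}=1$, $\hat q_{k,z}=\hat Q^{(n)}(\tau_k\mid z)$ for $k=1,\dots,m$ (if these estimated quantiles cross, i.e. are not increasing in $k$, they are re-arranged in increasing order). The estimator is the linear interpolation $$\hat F^{(m,n)}(t\mid z)=\sum_{k=0}^m\Big(\tau_k+(\tau_{k+1}-\tau_k)\frac{t-\hat q_{k,z}}{\hat q_{k+1,z}-\hat q_{k,z}}\Big)1_{(\hat q_{k,z},\hat q_{k+1,z}]}(t),\quad t\in[0,1].$$ For a nonzero sequence $a_n$, $X_n\in\mathcal{O}_P(a_n)$ means: for every $\epsilon>0$ there is $M>0$ with $\sup_{n\in\mathbb{N}}P(|X_n/a_n|>M)<\epsilon$.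
   Formalization: In the conclusion the supremum over z in the norm runs only over those z in [0,1]^d at which the density bound in (ii) holds (almost all z), not over all z; with the bound only for almost all z, the claim for all z fails. *)

(* Defs.v *)
From HB Require Import structures.
From mathcomp Require Import all_boot all_order all_algebra.
From mathcomp Require Import all_classical all_reals all_analysis.

Set Implicit Arguments.
Unset Strict Implicit.
Unset Printing Implicit Defensive.

Import Order.TTheory GRing.Theory Num.Theory.
Import numFieldNormedType.Exports.

Local Open Scope classical_set_scope.
Local Open Scope ring_scope.

Section euclidean.
Context (R : realType).

Definition cube (d : nat) : set (d.-tuple R) :=
  [set z | forall i, 0 <= tnth z i <= 1].

(* Lebesgue measure on R^d: the d-fold product of the one on R, transported
   along the coordinate bijection R x R^d -> R^(d+1). *)
Fixpoint lebesgue_tuple (d : nat) : set (d.-tuple R) -> \bar R :=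
  match d with
  | 0 => \d_ [tuple]
  | n.+1 => pushforward (lebesgue_measure \x @lebesgue_tuple n)%E
              (fun w : R * n.-tuple R => [tuple of w.1 :: w.2])
  end.

(* A point (x, y, z) is encoded as (x, (y, z)). *)
Definition lebesgue_obs (d : nat) : set (R * (R * d.-tuple R)) -> \bar R :=
  (lebesgue_measure \x (lebesgue_measure \x @lebesgue_tuple d))%E.

End euclidean.

Arguments cube : clear implicits.
Arguments lebesgue_tuple : clear implicits.
Arguments lebesgue_obs : clear implicits.

Notation law R d := (probability (R * (R * d.-tuple R))%type R).

Section model.
Context (R : realType) (d : nat).

Definition law_class : set (law R d) :=
  [set P | P (`[0, 1] `*` (`[0, 1] `*` cube R d)) = 1%E /\
           P `<< lebesgue_obs R d].

Definition proj_xz (w : R * (R * d.-tuple R)) : R * d.-tuple R :=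
  (w.1, w.2.2).

Definition cond_cdf (K : R.-pker (d.-tuple R) ~> R) (t : R) (z : d.-tuple R)
  : R := fine (K z `]-oo, t]%classic).

(* K is a regular conditional distribution of X given Z under P which, for
   every z in the cube, lives on [0, 1] and has a continuous distribution
   function. *)
Definition is_cond_law (P : law R d) (K : R.-pker (d.-tuple R) ~> R) : Prop :=
  [/\ forall (A : set R) (B : set (d.-tuple R)), measurable A -> measurable B ->
        P (proj_xz @^-1` (A `*` B)) =
        (\int[P]_(w in [set w | B w.2.2]) K w.2.2 A)%E,
      forall z, cube R d z -> K z `[0, 1]%classic = 1%E
    & forall z, cube R d z -> continuous (fun t => cond_cdf K t z)].

Definition cond_quantile (K : R.-pker (d.-tuple R) ~> R) (tau : R)
    (z : d.-tuple R) : R :=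
  inf [set t | 0 <= t <= 1 /\ tau <= cond_cdf K t z].

Definition is_cond_density (K : R.-pker (d.-tuple R) ~> R)
    (f : R -> d.-tuple R -> R) (z : d.-tuple R) : Prop :=
  [/\ measurable_fun [set: R] (fun x => f x z),
      forall x, 0 <= f x z
    & forall A, measurable A ->
        K z A = (\int[lebesgue_measure]_(x in A) (f x z)%:E)%E].

(* Conditional densities exist and are bounded only for almost every z. The
   present set consists of the z for which this does happen, and it is the range
   of the supremum over z in the norm of F - \hat F: at the exceptional z, where
   F(. | z) is merely continuous, an error of order a_n on the quantiles does
   not control the error on F. It is the whole cube if the bound holds for
   every z. *)
Definition bounded_density_set (K : R.-pker (d.-tuple R) ~> R)
    (f : R -> d.-tuple R -> R) (C : R) : set (d.-tuple R) :=
  [set z | [/\ cube R d z, is_cond_density K f z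
    & (ereal_sup [set (f x z)%:E | x in `[0%R, 1%R]] <= C%:E)%E]].

(* The norm ||f||_{T, oo}, with z ranging over Zs instead of the whole cube.
   Suprema are taken in the extended reals, so unbounded means +oo. *)
Definition norm_T (K : R.-pker (d.-tuple R) ~> R) (tmin tmax : R)
    (Zs : set (d.-tuple R)) (f : R -> d.-tuple R -> R) : \bar R :=
  ereal_sup [set ereal_sup [set (`|f t z|)%:E
      | t in `[cond_quantile K tmin z, cond_quantile K tmax z]] | z in Zs].

Definition quantile_error (K : R.-pker (d.-tuple R) ~> R) (tmin tmax : R)
    (Qhat : R -> d.-tuple R -> R) : \bar R :=
  ereal_sup [set ereal_sup [set (`|cond_quantile K tau z - Qhat tau z|)%:E
      | tau in `[tmin, tmax]] | z in cube R d].

End model.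

Arguments law_class : clear implicits.

Section grids.
Context (R : realType).

(* Grid points are tau 1, ..., tau m; the other values of tau are ignored. *)
Definition is_grid (tmin tmax : R) (m : nat) (tau : nat -> R) : Prop :=
  [/\ (2 <= m)%N, tau 1%N = tmin, tau m = tmax
    & forall k, (1 <= k < m)%N -> tau k < tau k.+1].

Definition equidistant (m : nat) (tau : nat -> R) : Prop :=
  exists h, forall k, (1 <= k < m)%N -> tau k.+1 - tau k = h.

Definition coarseness (m : nat) (tau : nat -> R) : R :=
  \big[Num.max/0]_(1 <= k < m) (tau k.+1 - tau k).

Definition node (m : nat) (tau : nat -> R) (k : nat) : R :=
  if k == 0%N then 0 else if k == m.+1 then 1 else tau k.

(* \hat q_{k, z}, with qhat tau = \hat Q(tau | z); sorting is the
   rearrangement of crossing quantiles and is the identity when they do not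
   cross. *)
Definition qnode (m : nat) (tau : nat -> R) (qhat : R -> R) (k : nat) : R :=
  node m
    (fun j => nth 0 (sort <=%R [seq qhat (tau i) | i <- iota 1 m]) j.-1) k.

(* When two nodes coincide the division by 0 is harmless, as the
   indicator of the empty interval vanishes. *)
Definition cdf_estimator (d m : nat) (tau : nat -> R)
    (Qhat : R -> d.-tuple R -> R) (t : R) (z : d.-tuple R) : R :=
  let q := qnode m tau (Qhat ^~ z) in
  \sum_(0 <= k < m.+1)
    (node m tau k + (node m tau k.+1 - node m tau k) *
       ((t - q k) / (q k.+1 - q k))) * \1_(`]q k, q k.+1]) t.

End grids.

Section sampling.
Context (R : realType) (dO : measure_display) (Omega : measurableType dO).

Definition iid_sample (d : nat) (Pr : probability Omega R) (P : law R d)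
    (S : nat -> {mfun Omega >-> (R * d.-tuple R)%type}) : Prop :=
  (forall i A, measurable A ->
     distribution Pr (S i) A = P (@proj_xz R d @^-1` A)) /\
  (forall (J : seq nat) (A : nat -> set (R * d.-tuple R)), uniq J ->
     (forall i, measurable (A i)) ->
     Pr (\bigcap_(i in [set` J]) (S i @^-1` A i)) =
     (\prod_(i <- J) Pr (S i @^-1` A i))%E).

(* O_P(a_n). Suprema over uncountable index sets need not be measurable, so
   the probability is the outer one, which agrees with Pr on events; X may
   take infinite values. Sample sizes n start at 1. *)
Definition bigO_P (Pr : probability Omega R) (X : nat -> Omega -> \bar R)
    (a : nat -> R) : Prop :=
  forall eps : R, 0 < eps -> exists2 M : R, 0 < M &
    (ereal_sup [set (Pr^*)%mu [set w | M%:E < `|X n w * ((a n)^-1)%:E|]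
       | n in [set n | (0 < n)%N]] < eps%:E)%E.

End sampling.

(* Main.v *)
Require Import Defs.
From HB Require Import structures.
From mathcomp Require Import all_boot all_order all_algebra.
From mathcomp Require Import all_classical all_reals all_analysis.
From mathcomp Require Import lra zify.
Set Implicit Arguments.
Unset Strict Implicit.
Unset Printing Implicit Defensive.

Import Order.TTheory GRing.Theory Num.Theory.
Import numFieldNormedType.Exports.
Local Open Scope classical_set_scope.
Local Open Scope ring_scope.

(** The estimation error of the distribution function is bounded, sample by
    sample, by the error on the quantiles:

      |F(t | z) - Fhat(t | z)| <= coarseness + 2 * C * quantile_error

    for every z at which the conditional density is bounded by C and every t in
    [Q(tmin | z), Q(tmax | z)] ([cdf_estimator_error]). Given this, a constant M
    that works for the quantile error at a level eps yields the constant
    B + 2 * C * M + 1 for the estimator at the same level, where B bounds the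
    ratio of the coarseness to the rate ([littleo_le_global]).

    The deterministic bound rests on two observations. First, a density bounded
    by C makes F(. | z) Lipschitz with constant C ([cond_cdf_lipschitz]), so that
    F(Q(tau | z) | z) = tau ([quantileK]) and an error e on a quantile costs at
    most C * e on the level. Second, sorting the estimated quantiles does not
    increase their largest distance to the true ones, which are already sorted
    ([sort_dist_le]).

    If t lies between two consecutive sorted estimates qhat_k and qhat_(k+1),
    the interpolant is between tau_k and tau_(k+1), and F(t | z) is in the same
    interval up to C * e. The range of t is given by the true quantiles, so t can
    also fall slightly outside [qhat_1, qhat_m], where the grid is not fine.
    There the interpolant is steep at worst with slope C, because a mass tmin
    spread with density at most C occupies at least tmin / C, and t is within e
    of the nearest estimate ([scaled_ratio_le], [interpolation_error]).

    The norm is a supremum over the z with a bounded density, in the extended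
    reals. It would be -oo if there were no such z, so the fact that the cube is
    not a null set is part of the argument ([ae_cube_ex]). *)

(** * Rearrangement is a contraction for the sup norm *)

Lemma nth_sort_le (R : realDomainType) (s : seq R) (k : nat) (x : R) :
  (k < count (fun y => (y <= x)%R) s)%N -> nth 0 (sort <=%R s) k <= x.
Proof.
move=> hk; rewrite leNgt; apply/negP => hx; move: hk.
rewrite -(count_sort <=%R) ltnNge => /negP; apply.
rewrite -[X in count _ X](cat_take_drop k) count_cat.
suff -> : count (fun y => (y <= x)%R) (drop k (sort <=%R s)) = 0%N.
  by rewrite addn0 (leq_trans (count_size _ _))// size_take_min geq_minl.
apply/eqP; rewrite -leqn0 leqNgt -has_count; apply/hasPn => y.
move=> /(nthP 0)[i]; rewrite size_drop nth_drop => hi <-.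
rewrite -ltNge (lt_le_trans hx)//.
by apply: (sorted_leq_nth le_trans le_refl 0 (sort_le_sorted s));
  rewrite ?inE /=; move: hi; rewrite ?size_sort; move: (size _) => n; lia.
Qed.

Lemma nth_sort_ge (R : realDomainType) (s : seq R) (k : nat) (x : R) :
  (k < size s)%N -> (size s - k <= count (fun y => (x <= y)%R) s)%N ->
  x <= nth 0 (sort <=%R s) k.
Proof.
move=> ks hk; rewrite leNgt; apply/negP => hx; move: hk; apply/negP.
rewrite -ltnNge -(count_sort <=%R).
rewrite -[X in count _ X](cat_take_drop k.+1) count_cat.
suff -> : count (fun y => (x <= y)%R) (take k.+1 (sort <=%R s)) = 0%N.
  rewrite add0n (leq_ltn_trans (count_size _ _))// size_drop size_sort.
  exact: ltn_sub2l ks (ltnSn k).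
apply/eqP; rewrite -leqn0 leqNgt -has_count; apply/hasPn => y.
move=> /(nthP 0)[i]; rewrite size_take_min size_sort => hi <-.
rewrite nth_take; last by lia.
rewrite -ltNge (le_lt_trans _ hx)//.
by apply: (sorted_leq_nth le_trans le_refl 0 (sort_le_sorted s));
  rewrite ?inE /=; move: hi ks; rewrite ?size_sort; move: (size _) => n; lia.
Qed.

(** Rearranging crossing quantiles costs nothing. As [a] is nondecreasing, the
    values [b 1], ..., [b k] are all at most [a k + e], so at least [k] entries
    of the sorted list are, the [k]-th one among them; the lower bound counts
    [b k], ..., [b m] in the same way. *)
Lemma sort_dist_le (R : realDomainType) (m : nat) (a b : nat -> R) (e : R) :
  (forall i j, (1 <= i)%N -> (i <= j <= m)%N -> a i <= a j) ->
  (forall i, (1 <= i <= m)%N -> `|a i - b i| <= e) ->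
  forall k, (1 <= k <= m)%N ->
    `|a k - nth 0 (sort <=%R [seq b i | i <- iota 1 m]) k.-1| <= e.
Proof.
move=> amono hab k km.
have hab' i : (1 <= i <= m)%N -> a i - e <= b i /\ b i <= a i + e.
  by move=> /hab; rewrite ler_distl => /andP[]; lra.
rewrite ler_distl; apply/andP; split.
  rewrite lerBlDr; apply: nth_sort_le.
  rewrite count_map -(subnKC (_ : k <= m)%N); last by lia.
  rewrite iotaD count_cat ltn_addr//.
  have -> : count (preim b (fun y => (y <= a k + e)%R)) (iota 1 k) = k.
    rewrite -[RHS](size_iota 1); apply/eqP; rewrite -all_count.
    apply/allP => i; rewrite mem_iota /= => hi.
    have := (hab' i) ltac:(lia); have := amono i k ltac:(lia) ltac:(lia); lra.
  lia.
rewrite -lerBlDr; apply: nth_sort_ge; rewrite size_map size_iota; first by lia.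
rewrite count_map.
have -> : iota 1 m = iota 1 k.-1 ++ iota k (m - k.-1)%N.
  by rewrite -[in LHS](subnKC (_ : k.-1 <= m)%N) ?iotaD ?add1n ?prednK//; lia.
rewrite count_cat -[leqLHS]add0n leq_add//.
rewrite -[leqLHS](size_iota k); apply: eq_leq; apply/esym/eqP.
rewrite -all_count; apply/allP => i; rewrite mem_iota /= => hi.
have := (hab' i) ltac:(lia); have := amono k i ltac:(lia) ltac:(lia); lra.
Qed.

(** * Quantiles of a Lipschitz distribution function *)

(** The defining infimum is attained because [F] is Lipschitz: if [F q] missed
    [tau] by some amount, moving [q] by that amount over [C] would not make up
    for the difference, and this contradicts the choice of [q] as an infimum. *)
Lemma quantileK (R : realType) (F : R -> R) (C tau : R) :
  {homo F : x y / x <= y} -> F 0 = 0 -> F 1 = 1 ->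
  (forall a b, a <= b -> F b - F a <= C * (b - a)) ->
  0 < tau <= 1 ->
  let q := inf [set t | 0 <= t <= 1 /\ tau <= F t] in
  0 <= q <= 1 /\ F q = tau.
Proof.
move=> Fmono F0 F1 Flip htau; set S := [set t | _]; move=> q.
have S1 : S 1 by rewrite /S /= F1 ler01 lexx; split => //; lra.
have Slb : lbound S 0 by move=> t [/andP[]].
have Shl : has_lbound S by exists 0.
have q0 : 0 <= q by apply: lb_le_inf => //; exists 1.
have q1 : q <= 1 by apply: ge_inf.
have C1 : 1 <= C by have := Flip 0 1 ler01; rewrite F0 F1; lra.
split; first by rewrite q0 q1.
apply/eqP; rewrite eq_le; apply/andP; split.
  rewrite leNgt; apply/negP => hlt.
  (* At this point to the left of q, F is still at least tau. *)
  pose s := q - (F q - tau) / C.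
  have hC : C * ((F q - tau) / C) = F q - tau.
    by rewrite mulrC divfK//; lra.
  have hd : 0 < (F q - tau) / C by apply: divr_gt0; lra.
  have Fs : tau <= F s by have := Flip s q; rewrite subKr hC /s; lra.
  have s0 : 0 <= s.
    rewrite leNgt; apply/negP => sn; have := Fmono s 0 (ltW sn).
    by rewrite F0; lra.
  have : S s by split => //; rewrite s0 /=; rewrite /s; lra.
  by move=> /(ge_inf Shl); rewrite -/q /s; lra.
rewrite leNgt; apply/negP => hlt.
have hC : C * ((tau - F q) / C) = tau - F q by rewrite mulrC divfK//; lra.
have hd : 0 < (tau - F q) / C by apply: divr_gt0; lra.
have hinf : has_inf S by split => //; exists 1.
have [s [s01 Fs] sq] := inf_adherent hd hinf.
rewrite -/q in sq.
have qs : q <= s by apply: ge_inf.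
have := Flip q s qs.
have : C * (s - q) < C * ((tau - F q) / C) by rewrite ltr_pM2l; lra.
lra.
Qed.

Lemma quantile_homo (R : realType) (F : R -> R) (tau tau' : R) :
  F 1 = 1 -> tau <= tau' -> tau' <= 1 ->
  inf [set t | 0 <= t <= 1 /\ tau <= F t] <=
  inf [set t | 0 <= t <= 1 /\ tau' <= F t].
Proof.
move=> F1 tt' t'1; apply: lb_le_inf.
  by exists 1; rewrite /= ler01 lexx F1.
move=> t [ht Ft]; apply: ge_inf; first by exists 0 => s [/andP[]].
by split => //; exact: le_trans Ft.
Qed.

(** * Linear interpolation between the nodes *)

(** The index is the least one with [t <= q k.+1], so the nodes may come in any
    order: estimated quantiles can lie outside of [[0, 1]], and then the end
    points [q 0 = 0] and [q m.+1 = 1] are not in line with the others. *)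
Lemma interval_find (R : realDomainType) (m : nat) (q : nat -> R) (t : R) :
  q 0%N < t -> t <= q m.+1 -> exists2 k, (k <= m)%N & q k < t <= q k.+1.
Proof.
move=> q0 qm; have ex : exists k, (t <= q k.+1)%R by exists m.
case: (ex_minnP ex) => k hk kmin; exists k; first exact: kmin.
rewrite hk andbT; case: k kmin {hk} => [//|k] kmin.
by rewrite ltNge; apply/negP => /kmin; rewrite ltnn.
Qed.

(** The intervals are disjoint as soon as the inner nodes are sorted. When [q 1]
    lies below [q 0], or [q m] above [q m.+1], the corresponding end interval is
    empty. *)
Lemma interpolation_eval (R : realDomainType) (m : nat) (q v : nat -> R)
    (t : R) (k : nat) :
  (forall i j, (1 <= i)%N -> (i <= j <= m)%N -> q i <= q j) ->
  (k <= m)%N -> q k < t <= q k.+1 ->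
  \sum_(0 <= j < m.+1) v j * \1_(`]q j, q j.+1]) t = v k.
Proof.
move=> qmono km hk.
rewrite (bigD1_seq k) ?mem_index_iota ?iota_uniq//=.
rewrite indicE mem_set ?mulr1 //= ?in_itv//=.
rewrite big_seq_cond big1 ?addr0// => j; rewrite mem_index_iota => /andP[jm jk].
rewrite indicE memNset ?mulr0//= in_itv/= => /andP[h1 h2].
case/andP: hk => h3 h4.
have [jk'|jk'] : (j < k)%N \/ (k < j)%N by lia.
  by have := qmono j.+1 k ltac:(lia) ltac:(lia); lra.
by have := qmono k.+1 j ltac:(lia) ltac:(lia); lra.
Qed.

(** The linear piece over an end interval of width [w] has slope [a / w], where
    [a] is the probability mass that lies beyond the extreme level. A density
    bounded by [C] cannot fit this mass into less than [a / C], so the slope is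
    at most [C]. *)
Lemma scaled_ratio_le (R : realFieldType) (a C u w e : R) :
  0 <= a -> 0 <= C -> 0 <= u -> 0 < w -> a <= C * w -> u <= e ->
  0 <= a * (u / w) <= C * e.
Proof.
move=> a0 C0 u0 w0 aC ue; apply/andP; split.
  by rewrite mulr_ge0// divr_ge0// ltW.
rewrite mulrA ler_pdivrMr// mulrAC; exact: ler_pM.
Qed.

(** On an inner interval [F t] and the interpolant both lie in
    [[tau k - C * e, tau k.+1 + C * e]], whence [kappa + C * e]. On an end
    interval the interpolant is on one side of the extreme level and [F t] on
    the other; each is within [C * e] of that level, which gives the factor
    2. *)
Lemma interpolation_error (R : realType) (F : R -> R) (C e kappa : R)
    (m : nat) (tau Q q : nat -> R) (t : R) :
  {homo F : x y / x <= y} ->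
  (forall a b, a <= b -> F b - F a <= C * (b - a)) ->
  0 <= C -> 0 <= e -> 0 <= kappa ->
  (0 < m)%N -> tau 0%N = 0 -> tau m.+1 = 1 ->
  F 0 = 0 -> F 1 = 1 ->
  (forall k, (1 <= k <= m)%N -> F (Q k) = tau k) ->
  (forall k, (1 <= k < m)%N -> 0 <= tau k.+1 - tau k <= kappa) ->
  0 < tau 1%N -> tau m < 1 ->
  q 0%N = 0 -> q m.+1 = 1 ->
  (forall k, (1 <= k <= m)%N -> `|Q k - q k| <= e) ->
  Q 1%N <= t <= Q m ->
  forall k, (k <= m)%N -> q k < t <= q k.+1 ->
  `|F t - (tau k + (tau k.+1 - tau k) * ((t - q k) / (q k.+1 - q k)))|
    <= kappa + 2 * C * e.
Proof.
move=> Fmono Flip C0 e0 kap0 m0 tau0 taum F0 F1 FQ htau tau1 taum1 q0 qm hq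
  ht k km hk.
have hq' i : (1 <= i <= m)%N -> Q i - e <= q i /\ q i <= Q i + e.
  by move=> /hq; rewrite ler_distl => /andP[]; lra.
have Ce : 0 <= C * e by apply: mulr_ge0.
have Fup i : (1 <= i <= m)%N -> t <= q i -> F t <= tau i + C * e.
  move=> im tq; have [_ h] := hq' i im.
  have := Flip (Q i) (Q i + e) ltac:(lra).
  have /Fmono : t <= Q i + e by lra.
  rewrite (FQ i im); lra.
have Flo i : (1 <= i <= m)%N -> q i <= t -> tau i - C * e <= F t.
  move=> im tq; have [h _] := hq' i im.
  have := Flip (Q i - e) (Q i) ltac:(lra).
  have /Fmono : Q i - e <= t by lra.
  rewrite (FQ i im); lra.
have m1 : (1 <= 1 <= m)%N by [].
have mm : (1 <= m <= m)%N by rewrite leqnn andbT.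
have /andP[Q1t tQm] := ht.
have Ft1 : tau 1%N <= F t by rewrite -(FQ 1%N m1) Fmono.
have Ftm : F t <= tau m by rewrite -(FQ m mm) Fmono.
have C1 : 0 < C by have := Flip 0 1 ler01; rewrite F0 F1; lra.
have [k0|k0] := posnP k.
  (* t lies in ]0, q 1], hence between Q 1 and Q 1 + e *)
  rewrite k0 q0 tau0 in hk *; rewrite !subr0 add0r.
  have tq : t <= q 1%N by case/andP: hk.
  have t0 : 0 < t by case/andP: hk.
  have := Fup 1%N m1 tq; have [_ hq1] := hq' 1%N m1.
  have tC : tau 1%N <= C * t.
    by apply: le_trans Ft1 _; have := Flip 0 t (ltW t0); rewrite F0 !subr0.
  have -> : t / q 1%N = 1 - (q 1%N - t) / q 1%N.
    by rewrite mulrBl divff ?opprB ?subrKC ?lt0r_neq0 ?(lt_le_trans t0).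
  have := @scaled_ratio_le _ (tau 1%N) C (q 1%N - t) (q 1%N) e.
  have tC' : tau 1%N <= C * q 1%N by apply: le_trans tC _; rewrite ler_pM2l.
  have ? : q 1%N - t <= e by clear -hq1 ht; lra.
  rewrite (ltW tau1) C0 subr_ge0 tq (lt_le_trans t0 tq) tC'.
  move=> /(_ isT isT isT isT isT)/(_ _)/andP[//|].
  set X := _ * (_ / _) => X0 Xe Fup1.
  rewrite mulrBr mulr1 -/X ler_norml.
  by clear - Ft1 X0 Xe Fup1 kap0 Ce; lra.
have [kE|kE] : (k = m \/ k < m)%N by clear -km; lia.
  (* t lies in ]q m, 1], hence between Q m - e and Q m *)
  rewrite kE qm taum in hk *.
  have qt : q m <= t by case/andP: hk => /ltW.
  have t1 : t <= 1 by case/andP: hk.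
  have := Flo m mm qt; have [hq1 _] := hq' m mm.
  have tC : 1 - tau m <= C * (1 - t).
    have := Flip t 1 t1; rewrite F1; apply: le_trans.
    by rewrite lerD2l lerN2.
  have tC' : 1 - tau m <= C * (1 - q m).
    by apply: le_trans tC _; rewrite ler_pM2l// lerD2l lerN2.
  have h1m : 0 < 1 - q m.
    by rewrite -(pmulr_rgt0 _ C1); apply: lt_le_trans tC'; rewrite subr_gt0.
  have := @scaled_ratio_le _ (1 - tau m) C (t - q m) (1 - q m) e.
  have ? : t - q m <= e by clear -hq1 ht; lra.
  rewrite subr_ge0 (ltW taum1) C0 subr_ge0 qt h1m tC'.
  move=> /(_ isT isT isT isT isT)/(_ _)/andP[//|].
  set X := _ * (_ / _) => X0 Xe Flom.
  rewrite ler_norml.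
  by clear - Ftm X0 Xe Flom kap0 Ce; lra.
have k1m : (1 <= k <= m)%N by clear - k0 kE; lia.
have kSm : (1 <= k.+1 <= m)%N by clear - k0 kE; lia.
have [qk tq] := andP hk.
have /andP[hT1 hT2] : 0 <= tau k.+1 - tau k <= kappa by apply: htau; rewrite k0.
have hlo := Flo k k1m (ltW qk).
have hup := Fup k.+1 kSm tq.
have r0 : 0 <= (t - q k) / (q k.+1 - q k).
  by rewrite divr_ge0// subr_ge0 ltW// (lt_le_trans qk).
have r1 : (t - q k) / (q k.+1 - q k) <= 1.
  by rewrite ler_pdivrMr ?subr_gt0 ?(lt_le_trans qk)// mul1r lerD2r.
have := ler_piMr hT1 r1; have := mulr_ge0 hT1 r0.
set X := _ * (_ / _) => X0 XT.
rewrite ler_norml; clear - X0 XT hlo hup hT1 hT2 Ce; lra.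
Qed.

(** * The unit cube is not negligible *)

(** The integral of a nonnegative function is the supremum of the integrals of
    the simple functions below it. The argument covers sections whose measure is
    not known to depend measurably on the point. *)
Lemma ge0_integral_monotone (d : measure_display) (T : measurableType d)
    (R : realType) (mu : {measure set T -> \bar R}) (f g : T -> \bar R) :
  (forall x, (0 <= f x)%E) -> (forall x, (f x <= g x)%E) ->
  (\int[mu]_x f x <= \int[mu]_x g x)%E.
Proof.
move=> f0 fg; rewrite !ge0_integralTE//; last first.
  by move=> x; exact: le_trans (fg x).
apply: ereal_sup_le => _ [h /= hf <-].
by exists h => //= x; exact: le_trans (fg x).
Qed.

Lemma lebesgue_tuple_ge0 (R : realType) (d : nat) (A : set (d.-tuple R)) :
  (0 <= lebesgue_tuple R d A)%E.
Proof.
elim: d A => [|d ih] A /=; first exact: measure_ge0.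
by apply: integral_ge0 => x _; exact: ih.
Qed.

(** Over a point of [[0, 1]] the section of [A] contains the cube of the next
    lower dimension, so the induction needs only monotonicity of the integral. *)
Lemma lebesgue_tuple_cube_ge1 (R : realType) (d : nat) (A : set (d.-tuple R)) :
  cube R d `<=` A -> (1 <= lebesgue_tuple R d A)%E.
Proof.
elim: d A => [|d ih] A cA /=.
  by rewrite diracE mem_set//; apply: cA => -[].
rewrite /pushforward /product_measure1.
have <- : (\int[lebesgue_measure]_x
    (\1_(`[0, 1]%classic : set R) x)%:E)%E = 1%E.
  rewrite integral_indic// setIT; have /= -> := @lebesgue_measure_itv R `[0, 1].
  by rewrite lte_fin ltr01 oppr0 adde0.
apply: ge0_integral_monotone => x; first by rewrite lee_fin.
rewrite indicE; case: (boolP (x \in _)) => [|_];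
  last exact: lebesgue_tuple_ge0.
rewrite inE/= in_itv/= => x01; apply: ih => z zc.
rewrite /xsection/= inE/=; apply: cA => i.
by case: (unliftP ord0 i) => [j ->|->]; rewrite ?tnthS ?tnth0.
Qed.

Lemma ae_cube_ex (R : realType) (d : nat) (S : set (d.-tuple R)) :
  {ae lebesgue_tuple R d, forall z, cube R d z -> S z} -> S !=set0.
Proof.
move=> [A [_ A0 hA]]; apply/set0P/eqP => S0.
have /lebesgue_tuple_cube_ge1 : cube R d `<=` A.
  by move=> z zc; apply: hA => /= /(_ zc); rewrite S0.
by rewrite A0 lee_fin ler10.
Qed.

(** * Conditional distribution functions with a bounded density *)

Lemma cond_law_fin_num (R : realType) (d : nat)
    (K : R.-pker (d.-tuple R) ~> R) (z : d.-tuple R) (A : set R) :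
  measurable A -> K z A \is a fin_num.
Proof.
move=> mA; rewrite ge0_fin_numE ?measure_ge0//.
apply: (@le_lt_trans _ _ (K z setT)); last by rewrite prob_kernel ltry.
by apply: le_measure; rewrite ?inE.
Qed.

Lemma cond_cdf_nondecreasing (R : realType) (d : nat)
    (K : R.-pker (d.-tuple R) ~> R) (z : d.-tuple R) :
  {homo (cond_cdf K ^~ z) : s t / s <= t}.
Proof.
move=> s t st; rewrite /cond_cdf fine_le ?cond_law_fin_num//.
by apply: le_measure; rewrite ?inE//; apply: subset_itvl; rewrite bnd_simp.
Qed.

Lemma measure_setI_full (d : measure_display) (T : measurableType d)
    (R : realType) (mu : {measure set T -> \bar R}) (A B : set T) :
  measurable A -> measurable B -> mu setT = 1%E -> mu B = 1%E ->
  mu (A `&` B) = mu A.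
Proof.
move=> mA mB muT muB.
have -> : mu A = (mu (A `\` B) + mu (A `&` B))%E by exact: measureDI.
suff -> : mu (A `\` B) = 0%E by rewrite add0e.
apply/eqP; rewrite eq_le measure_ge0 andbT.
have <- : mu (~` B) = 0%E.
  have : mu setT = (mu (setT `\` B) + mu (setT `&` B))%E by exact: measureDI.
  rewrite setTI setTD muT muB.
  by move=> /(congr1 (fun x => x - 1)%E); rewrite addeK// subee.
by apply: le_measure; rewrite ?inE//; [exact: measurableD|exact: measurableC].
Qed.

(** The density is bounded on [[0, 1]] only, but the part of [`]a, b]] outside
    [[0, 1]] carries no mass. *)
Lemma cond_cdf_lipschitz (R : realType) (d : nat)
    (K : R.-pker (d.-tuple R) ~> R) (f : R -> d.-tuple R -> R) (C a b : R) (z : d.-tuple R) :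
  0 <= C -> K z `[0, 1]%classic = 1%E ->
  bounded_density_set K f C z -> a <= b ->
  cond_cdf K b z - cond_cdf K a z <= C * (b - a).
Proof.
move=> C0 K1 [zc [mf f0 fK] fC] ab; rewrite lerBlDl -lee_fin EFinD /cond_cdf.
rewrite !fineK ?cond_law_fin_num//.
have -> : K z `]-oo, b]%classic =
    (K z `]-oo, a]%classic + K z `]a, b]%classic)%E.
  rewrite (@itv_bndbnd_setU _ _ _ (BRight a)) ?bnd_simp//.
  apply: measureU => //.
  by apply/seteqP; split => // x/=; rewrite !in_itv/=; lra.
set I := (X in K z X = _) in K1.
have mI : measurable I by exact: measurable_itv.
have <- : K z (`]a, b] `&` I) = K z `]a, b]%classic.
  by apply: measure_setI_full => //; exact: prob_kernel.
rewrite leeD2l// fK; last exact: measurableI.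
apply: (@le_trans _ _
    (\int[lebesgue_measure]_(x in `]a, b] `&` I) (cst C%:E x))%E).
  apply: ge0_le_integral => //; first exact: measurableI.
  - by move=> x _; rewrite lee_fin.
  - by apply/measurable_realfun.measurable_EFinP; exact: measurable_funTS.
  - move=> x [_ x01]; apply: le_trans fC; apply: ereal_sup_ubound.
    by exists x.
rewrite integral_cst; last exact: measurableI.
rewrite EFinM lee_wpmul2l ?lee_fin//.
apply: (@le_trans _ _ (lebesgue_measure (`]a, b] : set R))).
  by apply: le_measure; rewrite ?inE//; exact: measurableI.
rewrite lebesgue_measure_itv/= lte_fin; case: ifPn => // _.
by rewrite lee_fin subr_ge0.
Qed.

Lemma cond_cdf0 (R : realType) (d : nat) (K : R.-pker (d.-tuple R) ~> R)
    (f : R -> d.-tuple R -> R) (C : R) (z : d.-tuple R) :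
  K z `[0, 1]%classic = 1%E -> bounded_density_set K f C z ->
  cond_cdf K 0 z = 0.
Proof.
move=> K1 [zc [mf f0 fK] fC]; rewrite /cond_cdf.
have <- : K z (`]-oo, 0] `&` `[0, 1]) = K z `]-oo, 0]%classic.
  by apply: measure_setI_full => //; exact: prob_kernel.
have -> : `]-oo, 0] `&` `[0, 1] = [set 0] :> set R.
  by apply/seteqP; split => x /=; rewrite !in_itv/=; [lra|move=> ->; lra].
by rewrite fK// integral_set1.
Qed.

Lemma cond_cdf1 (R : realType) (d : nat) (K : R.-pker (d.-tuple R) ~> R)
    (z : d.-tuple R) :
  K z `[0, 1]%classic = 1%E -> cond_cdf K 1 z = 1.
Proof.
move=> K1; rewrite /cond_cdf.
have <- : K z (`]-oo, 1] `&` `[0, 1]) = K z `]-oo, 1]%classic.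
  by apply: measure_setI_full => //; exact: prob_kernel.
rewrite setIidr ?K1//.
by apply: subset_itv; rewrite bnd_simp.
Qed.

(** * The estimator at a fixed sample *)

Lemma node_inner (R : realType) (m k : nat) (tau : nat -> R) :
  (1 <= k <= m)%N -> node m tau k = tau k.
Proof.
move=> km; rewrite /node.
have -> : (k == 0)%N = false by lia.
by have -> : (k == m.+1)%N = false by lia.
Qed.

Lemma grid_homo (R : realType) (tmin tmax : R) (m : nat) (tau : nat -> R) :
  is_grid tmin tmax m tau ->
  forall i j, (1 <= i)%N -> (i <= j <= m)%N -> tau i <= tau j.
Proof.
move=> [_ _ _ tauS] i j i1; elim: j => [|j ih] ijm; first by lia.
have [->|ij] : (i = j.+1 \/ i <= j)%N by lia.
  by [].
by rewrite (le_trans (ih _)) ?ltW ?tauS//; lia.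
Qed.

Lemma step_le_coarseness (R : realType) (m k : nat) (tau : nat -> R) :
  (1 <= k < m)%N -> tau k.+1 - tau k <= coarseness m tau.
Proof.
move=> km.
apply: (@le_bigmax_seq _ _ _ _ 0 k xpredT (fun k => tau k.+1 - tau k)) => //.
by rewrite mem_index_iota.
Qed.

Lemma qnode_homo (R : realType) (m : nat) (tau : nat -> R) (qhat : R -> R)
    (i j : nat) :
  (1 <= i)%N -> (i <= j <= m)%N -> qnode m tau qhat i <= qnode m tau qhat j.
Proof.
move=> i1 ijm; rewrite /qnode !node_inner; try lia.
apply: (sorted_leq_nth le_trans le_refl 0 (sort_le_sorted _));
  by rewrite ?inE /= ?size_sort ?size_map ?size_iota; lia.
Qed.

(** The bound does not involve [z] or [t]; this uniformity is what lets it pass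
    to the suprema in [norm_T]. *)
Lemma cdf_estimator_error (R : realType) (d : nat)
    (K : R.-pker (d.-tuple R) ~> R) (f : R -> d.-tuple R -> R) (C e : R)
    (z : d.-tuple R) (tmin tmax : R) (m : nat) (tau : nat -> R)
    (Qhat : R -> d.-tuple R -> R) (t : R) :
  0 < tmin -> tmax < 1 -> 0 <= C -> 0 <= e ->
  K z `[0, 1]%classic = 1%E -> bounded_density_set K f C z ->
  is_grid tmin tmax m tau ->
  (forall u, tmin <= u <= tmax -> `|cond_quantile K u z - Qhat u z| <= e) ->
  cond_quantile K tmin z <= t <= cond_quantile K tmax z ->
  `|cond_cdf K t z - cdf_estimator m tau Qhat t z| <=
    coarseness m tau + 2 * C * e.
Proof.
move=> tmin0 tmax1 C0 e0 K1 zS grid hQ ht.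
have F0 := cond_cdf0 K1 zS; have F1 := cond_cdf1 K1.
have Flip a b : a <= b -> cond_cdf K b z - cond_cdf K a z <= C * (b - a).
  exact: (@cond_cdf_lipschitz _ _ K f).
have Fmono := @cond_cdf_nondecreasing _ _ K z.
have tauh := grid_homo grid.
have [m2 t1 tm tauS] := grid.
have m0 : (0 < m)%N by exact: ltnW.
have m1 : (1 <= 1 <= m)%N by [].
have mm : (1 <= m <= m)%N by rewrite leqnn andbT.
have taub k : (1 <= k <= m)%N -> tmin <= tau k <= tmax.
  by case/andP=> k1 km; rewrite -t1 -tm !tauh ?k1 ?km ?leqnn.
have QK u : tmin <= u <= tmax -> 0 <= cond_quantile K u z <= 1 /\
    cond_cdf K (cond_quantile K u z) z = u.
  move=> /andP[ul uu]; apply: (@quantileK _ _ C) => //.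
  by rewrite (lt_le_trans tmin0 ul) (le_trans uu (ltW tmax1)).
have tmm : tmin <= tmax by have := taub 1%N m1; rewrite t1 => /andP[_].
(* t is in ]0, 1], the range covered by the intervals between the nodes. *)
have t0 : 0 < t.
  rewrite ltNge; apply/negP => /Fmono; rewrite F0.
  have /Fmono : cond_quantile K tmin z <= t by case/andP: ht.
  have [_ ->] := QK tmin ltac:(by rewrite lexx).
  by clear - tmin0; lra.
have t1' : t <= 1.
  have [/andP[_ h] _] := QK tmax ltac:(by rewrite lexx andbT).
  by apply: le_trans h; case/andP: ht.
have nodeE k : (1 <= k <= m)%N -> node m tau k = tau k by exact: node_inner.
have nodem : node m tau m.+1 = 1 by rewrite /node eqxx.
pose q := qnode m tau (Qhat ^~ z).
have q0 : q 0%N = 0 by [].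
have qm : q m.+1 = 1 by rewrite /q /qnode /node eqxx.
have [k km hk] : exists2 k, (k <= m)%N & q k < t <= q k.+1.
  by apply: interval_find; rewrite ?q0 ?qm.
rewrite /cdf_estimator -/q.
rewrite (@interpolation_eval _ m q (fun k => node m tau k +
  (node m tau k.+1 - node m tau k) * ((t - q k) / (q k.+1 - q k))) t k)//;
  last exact: qnode_homo.
apply: (@interpolation_error _ (cond_cdf K ^~ z) C e (coarseness m tau) m
  (node m tau) (fun k => cond_quantile K (node m tau k) z)) => //.
- by apply: le_trans (step_le_coarseness (k := 1) tau m2);
    rewrite subr_ge0 ltW ?tauS//.
- by move=> i im; rewrite nodeE//; have [] := QK _ (taub i im).
- move=> i im; have /andP[i1 iltm] := im.
  rewrite !nodeE ?i1 ?(ltnW iltm)//.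
  by rewrite step_le_coarseness// andbT subr_ge0 ltW ?tauS.
- by rewrite nodeE// t1.
- by rewrite nodeE// tm.
- move=> i im; rewrite /q /qnode !nodeE// node_inner//.
  apply: (sort_dist_le (a := fun k => cond_quantile K (tau k) z)
                      (b := fun k => Qhat (tau k) z)) => // [a b a1 abm|j jm].
    apply: quantile_homo => //; first exact: tauh.
    have /andP[ab bm] := abm.
    have /andP[_ h] : tmin <= tau b <= tmax.
      by rewrite taub// bm (leq_trans a1).
    exact: le_trans h (ltW tmax1).
  exact/hQ/taub.
- by rewrite !nodeE// t1 tm.
Qed.

(** * From the pointwise bound to the rate *)

(** The relation [=o_\oo] only constrains large [n], whereas the supremum in
    [bigO_P] runs over every positive [n]; the finitely many remaining ratios are
    finite because [v] does not vanish. *)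
Lemma littleo_le_global (R : realType) (u v : nat -> R) :
  ((u : nat -> R^o) =o_\oo (v : nat -> R^o)) ->
  (forall n, (0 < n)%N -> v n != 0) ->
  exists2 B, 0 <= B & forall n, (0 < n)%N -> u n <= B * `|v n|.
Proof.
move=> /eqoP /(_ 1 ltr01)[N _ hN] v0.
pose S := \sum_(i < N) `|u i| / `|v i|.
have S0 : 0 <= S by apply: sumr_ge0 => i _; exact: divr_ge0.
exists (1 + S) => [|n n0]; first exact: addr_ge0.
apply: le_trans (ler_norm _) _.
have [Nn|nN] := leqP N n.
  apply: le_trans (hN n Nn) _; rewrite ler_wpM2r//.
  by rewrite lerDl.
rewrite -ler_pdivrMr ?normr_gt0 ?v0//.
rewrite /S (bigD1 (Ordinal nN))//= addrCA lerDl addr_ge0//.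
by apply: sumr_ge0 => i _; exact: divr_ge0.
Qed.

Lemma bounded_density_set_ge0 (R : realType) (d : nat)
    (K : R.-pker (d.-tuple R) ~> R) (f : R -> d.-tuple R -> R) (C : R) :
  bounded_density_set K f C !=set0 -> 0 <= C.
Proof.
move=> [z [_ [_ f0 _] fC]]; rewrite -lee_fin; apply: le_trans fC.
apply: le_ereal_sup_tmp; exists (f 0 z)%:E; last by rewrite lee_fin.
by exists 0; rewrite //= in_itv/= lexx ler01.
Qed.

Lemma norm_T_cdf_error (R : realType) (d : nat)
    (K : R.-pker (d.-tuple R) ~> R) (f : R -> d.-tuple R -> R) (C e : R)
    (tmin tmax : R) (m : nat) (tau : nat -> R) (Qhat : R -> d.-tuple R -> R) :
  0 < tmin -> tmax < 1 -> 0 <= C -> 0 <= e ->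
  (forall z, cube R d z -> K z `[0, 1]%classic = 1%E) ->
  is_grid tmin tmax m tau ->
  (quantile_error K tmin tmax Qhat <= e%:E)%E ->
  (norm_T K tmin tmax (bounded_density_set K f C)
    (fun t z => cond_cdf K t z - cdf_estimator m tau Qhat t z)%R
    <= (coarseness m tau + 2 * C * e)%:E)%E.
Proof.
move=> tmin0 tmax1 C0 e0 K1 grid hq.
apply: ge_ereal_sup => _ [z zS <-]; apply: ge_ereal_sup => _ [t tQ <-].
have [zc _ _] := zS; rewrite lee_fin.
apply: (cdf_estimator_error tmin0) zS grid _ _ => //; first exact: K1.
move=> u hu; rewrite -lee_fin; apply: le_trans hq.
apply: le_ereal_sup_tmp; eexists; first by exists z.
by apply: ereal_sup_ubound; exists u.
Qed.

(** A supremum over the empty set is -oo, whose absolute value +oo would exceed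
    every bound; hence the nonemptiness conditions. *)
Lemma norm_T_ge0 (R : realType) (d : nat)
    (K : R.-pker (d.-tuple R) ~> R) (tmin tmax : R) (Zs : set (d.-tuple R))
    (F : R -> d.-tuple R -> R) :
  Zs !=set0 ->
  (forall z, Zs z -> cond_quantile K tmin z <= cond_quantile K tmax z) ->
  (0 <= norm_T K tmin tmax Zs F)%E.
Proof.
move=> [z zS] hQ; apply: le_ereal_sup_tmp; eexists; first by exists z.
apply: le_ereal_sup_tmp; exists (`|F (cond_quantile K tmin z) z|)%:E.
  by exists (cond_quantile K tmin z); rewrite //= in_itv/= lexx hQ.
by rewrite lee_fin.
Qed.

Theorem theorem5 (R : realType) (d : nat) (tmin tmax : R)
  (htau : 0 < tmin /\ tmin < tmax /\ tmax < 1)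
  (* the class P_0, and for each P the conditional law of X given Z *)
  (P0 : set (law R d)) (hP0 : P0 `<=` law_class R d)
  (K : law R d -> R.-pker (d.-tuple R) ~> R)
  (hK : forall P, P0 P -> is_cond_law P (K P))
  (* an i.i.d. sample from each P, and the quantile regression procedure *)
  (dO : measure_display) (Omega : measurableType dO)
  (Pr : law R d -> probability Omega R)
  (S : law R d -> nat -> {mfun Omega >-> (R * d.-tuple R)%type})
  (hS : forall P, P0 P -> iid_sample (Pr P) P (S P))
  (Qhat : forall n : nat, n.-tuple (R * d.-tuple R) -> R -> d.-tuple R -> R)
  (* (i) *)
  (g : law R d -> nat -> R)
  (hg0 : forall P, P0 P -> forall n, (0 < n)%N -> g P n != 0)
  (hg : forall P, P0 P -> g P n @[n --> \oo] --> 0)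
  (hD : forall P, P0 P ->
    bigO_P (Pr P)
      (fun n w => quantile_error (K P) tmin tmax
                    (Qhat n [tuple S P i w | i < n])) (g P))
  (* (ii) *)
  (f : law R d -> R -> d.-tuple R -> R) (C : law R d -> R)
  (hf : forall P, P0 P ->
    {ae lebesgue_tuple R d, forall z, cube R d z ->
      bounded_density_set (K P) (f P) (C P) z}) :
  forall P, P0 P ->
  forall (m : nat -> nat) (tau : nat -> nat -> R),
    (forall n, (0 < n)%N -> is_grid tmin tmax (m n) (tau n)) ->
    (forall n, (0 < n)%N -> equidistant (m n) (tau n)) ->
    ((fun n => coarseness (m n) (tau n) : R^o) =o_\oo (g P : nat -> R^o)) ->
    bigO_P (Pr P)
      (fun n w => norm_T (K P) tmin tmax
         (bounded_density_set (K P) (f P) (C P))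
         (fun t z => cond_cdf (K P) t z -
            cdf_estimator (m n) (tau n)
              (Qhat n [tuple S P i w | i < n]) t z)) (g P).
Proof.
move=> P hP m tau hgrid _ hcoarse eps eps0.
have [tmin0 [tminmax tmax1]] := htau.
have [M M0 hM] := hD P hP eps eps0.
have [B B0 hB] := littleo_le_global hcoarse (hg0 P hP).
have [_ K1 _] := hK P hP.
have S0 : bounded_density_set (K P) (f P) (C P) !=set0 := ae_cube_ex (hf P hP).
have C0 := bounded_density_set_ge0 S0.
have CM0 : 0 <= 2 * C P * M by rewrite !mulr_ge0// ltW.
(* B bounds coarseness / |g|, and M bounds quantile_error / |g|; the final 1
   makes the constant positive. *)
exists (B + 2 * C P * M + 1); first by rewrite ltr_wpDl// addr_ge0.
apply: le_lt_trans hM; apply: ge_ereal_sup => _ [n n0 <-].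
apply: (@le_trans _ _ ((Pr P)^* [set w | M%:E < `|quantile_error (K P) tmin tmax
    (Qhat n [tuple S P i w | i < n]) * ((g P n)^-1)%:E|])%mu)%E; last first.
  by apply: ereal_sup_ubound; exists n.
(* The event that the estimation error is large is contained in the event that
   the quantile error is. *)
apply: le_mu_ext => w /=; rewrite !ltNge; apply: contra.
set qe := quantile_error _ _ _ _ => hqe.
set nT := norm_T _ _ _ _ _.
have g0 : 0 < `|g P n| by rewrite normr_gt0 hg0.
have scaleE (x : \bar R) (c : R) : (`|x * ((g P n)^-1)%:E| <= c%:E)%E =
    (`|x| <= (c * `|g P n|)%:E)%E.
  by rewrite abseM abse_EFin normfV lee_pdivrMr.
move: hqe; rewrite !scaleE => hqe.
have nT0 : (0 <= nT)%E.
  apply: norm_T_ge0 => // z [zc _ _]; apply: quantile_homo; rewrite ?ltW//.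
  by apply: cond_cdf1; exact: K1.
rewrite gee0_abs//.
apply: le_trans (norm_T_cdf_error (f P) tmin0 tmax1 C0
  (_ : 0 <= M * `|g P n|) K1 (hgrid n n0) _) _.
- by rewrite mulr_ge0 ?ltW.
- exact: le_trans (lee_abs _) hqe.
rewrite lee_fin mulrA -[in leRHS]addrA mulrDl mulrDl mulrDl mul1r.
have := hB n n0; have := ltW g0.
lra.
Qed.
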